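(* Let $\mathcal{H}$ be a complex Hilbert space and let $A,B,X\in\mathcal{B}(\mathcal{H})$ be such that the operators $A$, $X$, $X^{*}$, $B$ pairwise commute, $A$ is positive and invertible, and the operator matrix $$M=\begin{pmatrix} A & X\\ X^{*} & B\end{pmatrix}\in\mathcal{B}(\mathcal{H}\oplus\mathcal{H})$$ is positive. Put $\operatorname{tr}M:=A+B$, $\det M:=AB-X^{*}X$ and $Q:=(\det M)^{1/2}$. Then $\operatorname{tr}M+2Q$ is positive and invertible, and $$\sqrt{M}=\begin{pmatrix} (\operatorname{tr}M+2Q)^{-1/2} & 0\\ 0 & (\operatorname{tr}M+2Q)^{-1/2}\end{pmatrix}\begin{pmatrix} A+Q & X\\ X^{*} & B+Q\end{pmatrix}.$$
   Context: $\sqrt{M}$ denotes the unique positive square root of the positive operator $M$. Under the hypotheses, $\det M$ is a positive operator lying in the abelian unital $C^*$-algebra generated by $A,X,B$, so $Q$ is its positive square root. *)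

(* Defs.v *)
From HB Require Import structures.
From mathcomp Require Import all_boot all_order all_algebra.
From mathcomp Require Import complex.
From mathcomp Require Import reals.
From Stdlib Require Import ClassicalEpsilon.

Set Implicit Arguments.
Unset Strict Implicit.
Unset Printing Implicit Defensive.
Import Order.TTheory GRing.Theory Num.Theory.
Local Open Scope ring_scope.

Section Hilbert.
Variable R : realType.
Variable V : lmodType R[i].
Variable ip : V -> V -> R[i].

Definition hnorm (x : V) : R := Num.sqrt (complex.Re (ip x x)).

Definition cauchy_seq (u : nat -> V) : Prop :=
  forall e : R, 0 < e -> exists N : nat,
    forall m n : nat, (N <= m)%N -> (N <= n)%N -> hnorm (u m - u n) < e.

Definition converges_to (u : nat -> V) (l : V) : Prop :=
  forall e : R, 0 < e -> exists N : nat,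
    forall n : nat, (N <= n)%N -> hnorm (u n - l) < e.

Record is_hilbert : Prop := IsHilbert {
  ip_linear : forall (a : R[i]) (x y z : V), ip (a *: x + y) z = a * ip x z + ip y z;
  ip_conj : forall x y : V, ip y x = (ip x y)^*;
  ip_ge0 : forall x : V, 0 <= ip x x;
  ip_def : forall x : V, ip x x = 0 -> x = 0;
  ip_complete : forall u : nat -> V, cauchy_seq u -> exists l : V, converges_to u l
}.

Definition bounded_op (T : V -> V) : Prop :=
  (forall (a : R[i]) (x y : V), T (a *: x + y) = a *: T x + T y) /\
  exists c : R, forall x : V, hnorm (T x) <= c * hnorm x.

Definition is_adjoint (T S : V -> V) : Prop :=
  forall x y : V, ip (T x) y = ip x (S y).

Definition commute_op (T S : V -> V) : Prop := forall x : V, T (S x) = S (T x).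

(* positive operator: <T x, x> >= 0 for all x (order of R[i]: real and >= 0) *)
Definition positive_op (T : V -> V) : Prop :=
  bounded_op T /\ forall x : V, 0 <= ip (T x) x.

Definition is_inverse_op (T S : V -> V) : Prop :=
  bounded_op S /\ (forall x, S (T x) = x) /\ (forall x, T (S x) = x).

Definition invertible_op (T : V -> V) : Prop := exists S, is_inverse_op T S.

Definition is_pos_sqrt (T S : V -> V) : Prop :=
  positive_op S /\ forall x : V, S (S x) = T x.

(* T^{-1} and sqrt T (the unique positive square root), chosen by
   description; they are meaningful exactly when they exist. *)
Definition inv_op (T : V -> V) : V -> V :=
  epsilon (inhabits (fun x : V => x)) (is_inverse_op T).

Definition sqrt_op (T : V -> V) : V -> V :=
  epsilon (inhabits (fun x : V => x)) (is_pos_sqrt T).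

End Hilbert.

Definition ip_sum (R : realType) (V : lmodType R[i]) (ip : V -> V -> R[i])
  (p q : V * V) : R[i] := ip p.1 q.1 + ip p.2 q.2.

Definition op_matrix (R : realType) (V : lmodType R[i]) (T11 T12 T21 T22 : V -> V)
  (p : V * V) : V * V := (T11 p.1 + T12 p.2, T21 p.1 + T22 p.2).

(* Main.v *)
(** The positive square root of [1 - K], for a selfadjoint contraction [K], is [1 - Y] where
    [Y = (K + Y^2) / 2] is the limit of [Y_(n+1) = (K + Y_n^2) / 2], [Y_0 = 0]. The scalar
    iteration [r_(n+1) = (1 + r_n^2) / 2] majorizes it, in the sense that
    [|Y_(n+1) - Y_n| <= r_(n+1) - r_n], and stays below 1. So positive square roots exist and
    commute with whatever commutes with the operator. Uniqueness: if [S] and [P] are commuting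
    positive roots and [d = P - S], then [d P d + d S d = 0] forces [P d = S d = 0], whence
    [d^2 = 0].

    For the matrix [M], testing positivity on the vectors [(- X w, A w)] gives
    [A^(1/2) (det M) A^(1/2) >= 0], hence [det M >= 0]. Since [T = tr M + 2 Q >= A], the operator
    [T] is coercive, and a Neumann series inverts it. The matrix [N = T^(-1/2) (M + Q)] is
    positive because it equals [T^(-1/4) (M + Q) T^(-1/4)], and [(M + Q)^2 = T M] by
    [Q^2 = det M] (Cayley-Hamilton), so [N^2 = M]. *)

Require Import Defs.
From HB Require Import structures.
From mathcomp Require Import all_boot all_order all_algebra.
From mathcomp Require Import complex.
From mathcomp Require Import reals.
From mathcomp Require Import ring lra.

Import Order.TTheory GRing.Theory Num.Theory.
Local Open Scope ring_scope.

Set Implicit Arguments.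
Unset Strict Implicit.
Unset Printing Implicit Defensive.

(** * Linear maps, and the Cauchy-Schwarz inequality for real forms *)

Section LinearMaps.
Variables (K : pzRingType) (V : lmodType K) (T : V -> V).
Hypothesis linT : forall (a : K) (x y : V), T (a *: x + y) = a *: T x + T y.

Lemma linmapD x y : T (x + y) = T x + T y.
Proof. by rewrite -[x]scale1r linT !scale1r. Qed.

Lemma linmap0 : T 0 = 0.
Proof. by apply: (addrI (T 0)); rewrite -linmapD !addr0. Qed.

Lemma linmapZ a x : T (a *: x) = a *: T x.
Proof. by rewrite -[a *: x]addr0 linT linmap0 addr0. Qed.

Lemma linmapN x : T (- x) = - T x.
Proof. by rewrite -scaleN1r linmapZ scaleN1r. Qed.

Lemma linmapB x y : T (x - y) = T x - T y.
Proof. by rewrite linmapD linmapN. Qed.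

End LinearMaps.


(** The form is tested at [s x + t y] with [s = b y y], [t = - b x y], or with the roles exchanged
    when [b y y = 0]; if both squares vanish, [t = 1] and [t = -1] force [b x y = 0]. Semidefinite
    forms over real scalars cover both [rip] and the form of a positive operator. *)
Lemma Cauchy_Schwarz_form (R : realType) (V : lmodType R[i]) (b : V -> V -> R) :
  (forall x y z, b (x + y) z = b x z + b y z) ->
  (forall (c : R) x y, b (c%:C%C *: x) y = c * b x y) ->
  (forall x y, b x y = b y x) -> (forall x, 0 <= b x x) ->
  forall x y, b x y ^+ 2 <= b x x * b y y.
Proof.
move=> bD bZ bC b0 x y.
have key s t : 0 <= s ^+ 2 * b x x + 2 * s * t * b x y + t ^+ 2 * b y y.
  have := b0 (s%:C%C *: x + t%:C%C *: y).
  rewrite bD !bZ (bC x) (bC y) !bD !bZ (bC y x); congr (0 <= _); ring.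
have hx := b0 x; have hy := b0 y.
have [y0|y0] := eqVneq (b y y) 0; last first.
  have {}y0 : 0 < b y y by rewrite lt_def y0.
  have := key (b y y) (- b x y); set u := b x y; set p := b x x; set q := b y y in y0 *.
  have -> : q ^+ 2 * p + 2 * q * - u * u + (- u) ^+ 2 * q = q * (p * q - u ^+ 2) by ring.
  by rewrite pmulr_rge0 // subr_ge0.
have [x0|x0] := eqVneq (b x x) 0; last first.
  have {}x0 : 0 < b x x by rewrite lt_def x0.
  have := key (- b x y) (b x x); set u := b x y; set p := b x x in x0 *; set q := b y y.
  have -> : (- u) ^+ 2 * p + 2 * - u * p * u + p ^+ 2 * q = p * (p * q - u ^+ 2) by ring.
  by rewrite pmulr_rge0 // subr_ge0.
have := key 1 1; have := key 1 (-1); rewrite x0 y0 => h1 h2.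
have -> : b x y = 0 by lra.
by rewrite expr0n /= mul0r.
Qed.

(** * The underlying real inner product and the norm *)

Section Hilbert.
Variables (R : realType) (V : lmodType R[i]) (ip : V -> V -> R[i]).
Hypothesis hilb : is_hilbert ip.

Local Notation hnorm := (hnorm ip).
Local Notation bounded_op := (bounded_op ip).
Local Notation positive_op := (positive_op ip).
Local Notation converges_to := (converges_to ip).

(** This real inner product has the same norm and still separates vectors, so identities between
    operators can be tested on it by real arithmetic, without conjugates. *)
Definition rip (x y : V) : R := complex.Re (ip x y).

Lemma Re_conj (z : R[i]) : complex.Re (z^* ) = complex.Re z.
Proof. by case: z. Qed.

Lemma Im_conj (z : R[i]) : complex.Im (z^* ) = - complex.Im z.
Proof. by case: z. Qed.

Lemma ReD (z w : R[i]) : complex.Re (z + w) = complex.Re z + complex.Re w.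
Proof. by case: z; case: w. Qed.

Lemma ImD (z w : R[i]) : complex.Im (z + w) = complex.Im z + complex.Im w.
Proof. by case: z; case: w. Qed.

Lemma ReM (z w : R[i]) :
  complex.Re (z * w) = complex.Re z * complex.Re w - complex.Im z * complex.Im w.
Proof. by case: z; case: w. Qed.

Lemma ImM (z w : R[i]) :
  complex.Im (z * w) = complex.Re z * complex.Im w + complex.Im z * complex.Re w.
Proof. by case: z; case: w. Qed.

Lemma ipD x y z : ip (x + y) z = ip x z + ip y z.
Proof. by rewrite -[x]scale1r (ip_linear hilb) !scale1r mul1r. Qed.

Lemma ip0 z : ip 0 z = 0.
Proof. by apply: (addrI (ip 0 z)); rewrite -ipD !addr0. Qed.

Lemma ipZ a x z : ip (a *: x) z = a * ip x z.
Proof. by rewrite -[a *: x]addr0 (ip_linear hilb) ip0 addr0. Qed.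

Lemma rip_sym x y : rip x y = rip y x.
Proof. by rewrite /rip (ip_conj hilb) Re_conj. Qed.

Lemma ripDl x y z : rip (x + y) z = rip x z + rip y z.
Proof. by rewrite /rip ipD ReD. Qed.

Lemma ripZl (c : R) x y : rip (c%:C%C *: x) y = c * rip x y.
Proof. by rewrite /rip ipZ ReM /= mul0r subr0. Qed.

Lemma ripNl x y : rip (- x) y = - rip x y.
Proof. by rewrite -scaleN1r -(rmorph1 (real_complex R)) -rmorphN ripZl mulN1r. Qed.

Lemma rip0l y : rip 0 y = 0. Proof. by rewrite /rip ip0. Qed.

Lemma ripMnl x y n : rip (x *+ n) y = n%:R * rip x y.
Proof.
elim: n => [|n IH]; first by rewrite mulr0n rip0l mul0r.
by rewrite mulrS ripDl IH mulrS mulrDl mul1r.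
Qed.

Lemma ripDr x y z : rip z (x + y) = rip z x + rip z y.
Proof. by rewrite !(rip_sym z) ripDl. Qed.

Lemma ripZr (c : R) x y : rip y (c%:C%C *: x) = c * rip y x.
Proof. by rewrite !(rip_sym y) ripZl. Qed.

Lemma ripNr x y : rip y (- x) = - rip y x.
Proof. by rewrite !(rip_sym y) ripNl. Qed.

Lemma ripMnr x y n : rip y (x *+ n) = n%:R * rip y x.
Proof. by rewrite !(rip_sym y) ripMnl. Qed.

Definition ripE := (ripDl, ripDr, ripZl, ripZr, ripNl, ripNr, ripMnl, ripMnr).

Lemma rip_ge0 x : 0 <= rip x x.
Proof. by have := ip_ge0 hilb x; rewrite lecE => /andP[]. Qed.

Lemma rip_eq0 x : rip x x = 0 -> x = 0.
Proof.
move=> h; apply: (ip_def hilb); have := ip_ge0 hilb x; rewrite lecE => /andP[/eqP/= im0 _].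
by move: h im0; rewrite /rip; case: (ip x x) => a b /= -> ->.
Qed.

Lemma rip_ext x y : (forall z, rip x z = rip y z) -> x = y.
Proof.
by move=> h; apply/eqP; rewrite -subr_eq0; apply/eqP/rip_eq0; rewrite ripDl ripNl h subrr.
Qed.

Lemma hnorm_ge0 x : 0 <= hnorm x. Proof. exact: sqrtr_ge0. Qed.

Lemma hnorm_sqr x : hnorm x ^+ 2 = rip x x.
Proof. by rewrite sqr_sqrtr // rip_ge0. Qed.

Lemma hnorm_eq0 x : hnorm x = 0 -> x = 0.
Proof. by move=> h; apply: rip_eq0; rewrite -hnorm_sqr h expr0n. Qed.

Lemma hnorm_le x c : 0 <= c -> rip x x <= c ^+ 2 -> hnorm x <= c.
Proof. by move=> c0; rewrite -hnorm_sqr ler_sqr // nnegrE hnorm_ge0. Qed.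

Lemma rip_le x y : `|rip x y| <= hnorm x * hnorm y.
Proof.
have h0 : 0 <= hnorm x * hnorm y by rewrite mulr_ge0 ?hnorm_ge0.
rewrite -(@ler_pXn2r _ 2) ?nnegrE // real_normK ?num_real // exprMn !hnorm_sqr.
exact: Cauchy_Schwarz_form ripDl ripZl rip_sym rip_ge0 x y.
Qed.

Lemma hnormD x y : hnorm (x + y) <= hnorm x + hnorm y.
Proof.
apply: hnorm_le; first by rewrite addr_ge0 ?hnorm_ge0.
rewrite !ripE (rip_sym y x) -!hnorm_sqr.
have := le_trans (ler_norm _) (rip_le x y); nra.
Qed.

Lemma hnormZ a x :
  hnorm (a *: x) = Num.sqrt (complex.Re a ^+ 2 + complex.Im a ^+ 2) * hnorm x.
Proof.
have a0 : 0 <= complex.Re a ^+ 2 + complex.Im a ^+ 2 by rewrite addr_ge0 ?sqr_ge0.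
rewrite /Defs.hnorm -sqrtrM //; congr (Num.sqrt _).
rewrite ipZ (ip_conj hilb) ipZ -[ip x x]/(ip x x).
have := ip_ge0 hilb x; rewrite lecE => /andP[/eqP/= im0 _].
rewrite ReM Re_conj Im_conj ReM ImM im0; ring.
Qed.

Lemma hnormZr (c : R) x : 0 <= c -> hnorm (c%:C%C *: x) = c * hnorm x.
Proof. by move=> c0; rewrite hnormZ /= expr0n addr0 sqrtr_sqr ger0_norm. Qed.

Lemma hnormN x : hnorm (- x) = hnorm x.
Proof. by rewrite /Defs.hnorm -!/(rip _ _) !ripE opprK. Qed.

Lemma hnormB x y : hnorm (x - y) = hnorm (y - x).
Proof. by rewrite -hnormN opprB. Qed.

Lemma hnorm0 : hnorm 0 = 0.
Proof. by rewrite /Defs.hnorm ip0 sqrtr0. Qed.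

Lemma hnorm_triangle y x z : hnorm (x - z) <= hnorm (x - y) + hnorm (y - z).
Proof. by have := hnormD (x - y) (y - z); rewrite addrA subrK. Qed.

(** * Bounded operators *)

Lemma bounded_ge0 T : bounded_op T ->
  exists2 c, 0 < c & forall x, hnorm (T x) <= c * hnorm x.
Proof.
(* Adding 1 makes the bound strictly positive, so that it can be divided by. *)
case=> _ [c hc]; exists (`|c| + 1); first by rewrite ltr_wpDl.
move=> x; apply: le_trans (hc x) _; rewrite ler_wpM2r ?hnorm_ge0 //.
by apply: le_trans (ler_norm c) _; rewrite lerDl.
Qed.

Lemma bounded_comp T S : bounded_op T -> bounded_op S -> bounded_op (fun x => T (S x)).
Proof.
move=> bT bS; split=> [a x y|]; first by rewrite bS.1 bT.1.
have [c c0 hc] := bounded_ge0 bT; have [d d0 hd] := bounded_ge0 bS.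
exists (c * d) => x; apply: le_trans (hc _) _.
by rewrite -mulrA ler_pM2l.
Qed.

Lemma bounded_add T S : bounded_op T -> bounded_op S -> bounded_op (fun x => T x + S x).
Proof.
move=> [lT [c hc]] [lS [d hd]]; split=> [a x y|].
  by rewrite lT lS scalerDr addrACA.
by exists (c + d) => x; rewrite mulrDl (le_trans (hnormD _ _)) ?lerD.
Qed.

Lemma bounded_scale a : bounded_op (fun x => a *: x).
Proof.
split=> [c x y|]; last by eexists => x; rewrite hnormZ.
by rewrite scalerDr !scalerA mulrC.
Qed.

Lemma bounded_id : bounded_op id.
Proof. by split=> //; exists 1 => x; rewrite mul1r. Qed.

Lemma bounded_opp T : bounded_op T -> bounded_op (fun x => - T x).
Proof.
move=> [lT [c hc]]; split=> [a x y|]; first by rewrite lT opprD scalerN.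
by exists c => x; rewrite hnormN.
Qed.

Lemma bounded_sub T S : bounded_op T -> bounded_op S -> bounded_op (fun x => T x - S x).
Proof. by move=> bT bS; apply: bounded_add bT (bounded_opp bS). Qed.

(** Since [|S y|^2 = <T (S y), y> <= c |S y| |y|], dividing by [|S y|] bounds [S] by the same
    constant as [T]. *)
Lemma bounded_adjoint T S : bounded_op T -> is_adjoint ip T S -> bounded_op S.
Proof.
move=> bT adj; split=> [a x y|].
  have adj' u v : ip (S u) v = ip u (T v) by rewrite (ip_conj hilb) -adj -(ip_conj hilb).
  by apply: rip_ext => z; rewrite /rip adj' ipD ipZ -!adj' -ipZ -ipD.
have [c c0 hc] := bounded_ge0 bT; exists c => y.
have [s0|s0] := eqVneq (hnorm (S y)) 0; first by rewrite s0 mulr_ge0 ?hnorm_ge0 ?ltW.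
have {}s0 : 0 < hnorm (S y) by rewrite lt_def s0 hnorm_ge0.
rewrite -(ler_pM2l s0) -expr2 hnorm_sqr /rip -adj -/(rip _ _).
apply: le_trans (ler_norm _) (le_trans (rip_le _ _) _).
by rewrite mulrCA mulrA ler_wpM2r ?hnorm_ge0.
Qed.

(** * Positive operators and their quadratic forms *)

Lemma positive_rip T : positive_op T -> forall x, 0 <= rip (T x) x.
Proof. by move=> [_ h] x; have := h x; rewrite lecE => /andP[]. Qed.

(* Over the complex scalars a positive form is hermitian: polarize at y and at i y. *)
Lemma positive_sym T : positive_op T -> forall x y, rip (T x) y = rip x (T y).
Proof.
move=> [[lT _] h] x y.
have im0 z : complex.Im (ip (T z) z) = 0.
  by have := h z; rewrite lecE => /andP[/eqP].
have ipDr u v w : ip w (u + v) = ip w u + ip w v.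
  by rewrite (ip_conj hilb) ipD rmorphD /= -!(ip_conj hilb).
have ipZr a u w : ip w (a *: u) = a^* * ip w u.
  by rewrite (ip_conj hilb) ipZ rmorphM /= -!(ip_conj hilb).
have := im0 ('i%C *: x + y).
rewrite lT !ipD !ipDr !ipZ !ipZr !ImD !(ImM, ReM, Re_conj, Im_conj) /=.
rewrite !im0 (rip_sym x) /rip; lra.
Qed.

(** Symmetry of the real part at the pair [i x], [x] equates the imaginary part of [<T x, x>] with
    its opposite, so the form is real. *)
Lemma positive_intro T : bounded_op T -> (forall x y, rip (T x) y = rip x (T y)) ->
  (forall x, 0 <= rip (T x) x) -> positive_op T.
Proof.
move=> bT sT pT; split=> // x; rewrite lecE [0 <= _]pT andbT /=.
have := sT ('i%C *: x) x; rewrite (linmapZ bT.1) rip_sym (rip_sym _ (T x)) /rip.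
rewrite (ip_conj hilb) [ip (T x) _](ip_conj hilb) !ipZ !Re_conj !ReM /=.
rewrite (ip_conj hilb (T x) x) Im_conj => e; apply/eqP; lra.
Qed.

Lemma positive_CS T : positive_op T -> forall x y,
  rip (T x) y ^+ 2 <= rip (T x) x * rip (T y) y.
Proof.
move=> pT; apply: (@Cauchy_Schwarz_form _ _ (fun x y => rip (T x) y)) (positive_rip pT).
- by move=> x y z; rewrite (linmapD pT.1.1) ripDl.
- by move=> c x y; rewrite (linmapZ pT.1.1) ripZl.
- by move=> x y; rewrite (positive_sym pT) rip_sym.
Qed.

Lemma positive_ker T x : positive_op T -> rip (T x) x = 0 -> T x = 0.
Proof.
move=> pT h; apply: rip_eq0; have := positive_CS pT x (T x); rewrite h mul0r => e.
by apply/eqP; rewrite -sqrf_eq0 eq_le e sqr_ge0.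
Qed.

(** This is [T^2 <= c T]: Cauchy-Schwarz for the form of [T] at [x] and [T x] gives
    [|T x|^4 <= <T x, x> c |T x|^2]. *)
Lemma positive_norm_sqr T c : positive_op T -> (forall x, rip (T x) x <= c * rip x x) ->
  forall x, rip (T x) (T x) <= c * rip (T x) x.
Proof.
move=> pT hc x; have := positive_CS pT x (T x).
have [->|n0] := eqVneq (T x) 0.
  by rewrite !rip0l mulr0.
have {}n0 : 0 < rip (T x) (T x).
  by rewrite lt_def rip_ge0 andbT; apply: contra_neq n0 => /rip_eq0.
move=> h; rewrite -(ler_pM2r n0) -expr2; apply: le_trans h _.
rewrite [c * _]mulrC -mulrA.
by rewrite ler_wpM2l ?positive_rip.
Qed.

(** * Convergence in norm *)

Lemma converges_unique u l l' : converges_to u l -> converges_to u l' -> l = l'.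
Proof.
move=> hl hl'; apply/eqP; rewrite -subr_eq0; apply/eqP/hnorm_eq0/eqP.
rewrite eq_le hnorm_ge0 andbT; apply/ler_addgt0Pr => e e0; rewrite add0r.
have e2 : 0 < e / 2 by lra.
have [N hN] := hl _ e2; have [N' hN'] := hl' _ e2.
have := hN _ (leq_maxl N N'); have := hN' _ (leq_maxr N N').
have := hnorm_triangle (u (maxn N N')) l l'; rewrite (hnormB l (u _)); lra.
Qed.

Lemma converges_cst l : converges_to (fun=> l) l.
Proof. by move=> e e0; exists 0%N => n _; rewrite subrr hnorm0. Qed.

Lemma converges_add u v l m : converges_to u l -> converges_to v m ->
  converges_to (fun n => u n + v n) (l + m).
Proof.
move=> hu hv e e0; have e2 : 0 < e / 2 by lra.
have [N hN] := hu _ e2; have [N' hN'] := hv _ e2.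
exists (maxn N N') => n; rewrite geq_max => /andP[/hN h /hN' h'].
have := hnormD (u n - l) (v n - m); rewrite addrACA -opprD; lra.
Qed.

Lemma converges_bounded T u l : bounded_op T -> converges_to u l ->
  converges_to (fun n => T (u n)) (T l).
Proof.
move=> bT hu e e0; have [c c0 hc] := bounded_ge0 bT.
have ec : 0 < e / c by rewrite divr_gt0.
have [N hN] := hu _ ec; exists N => n /hN h.
rewrite -(linmapB bT.1); apply: le_lt_trans (hc _) _.
by rewrite mulrC -ltr_pdivlMr.
Qed.

Lemma converges_shift u l : converges_to u l -> converges_to (fun n => u n.+1) l.
Proof. by move=> h e /h[N hN]; exists N => n Nn; apply: hN; apply: leqW. Qed.

Lemma converges_eq u v l : (forall n, u n = v n) -> converges_to u l -> converges_to v l.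
Proof. by move=> h hu e /hu[N hN]; exists N => n /hN; rewrite h. Qed.

Lemma converges_norm_le u l c : (forall n, hnorm (u n) <= c) -> converges_to u l -> hnorm l <= c.
Proof.
move=> hc hu; apply/ler_addgt0Pr => e /hu[N hN].
have := hN _ (leqnn N); have := hc N; have := hnorm_triangle (u N) l 0.
rewrite !subr0 hnormB; lra.
Qed.

Lemma converges_rip u v l m x y : (forall n, rip (u n) y = rip x (v n)) ->
  converges_to u l -> converges_to v m -> rip l y = rip x m.
Proof.
move=> h hu hv; apply/eqP; rewrite -subr_eq0 -normr_eq0 eq_le normr_ge0 andbT.
apply/ler_addgt0Pr => e e0; rewrite add0r.
(* The error is at most [(|x| + |y|) e / c]; the extra 1 keeps [c] positive even for null
   vectors. *)
have [hx hy] := (hnorm_ge0 x, hnorm_ge0 y); pose c := hnorm x + hnorm y + 1.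
have c0 : 0 < c by rewrite /c; lra.
have ec : 0 < e / c by rewrite divr_gt0.
have [N hN] := hu _ ec; have [N' hN'] := hv _ ec.
have {}hN := hN _ (leq_maxl N N'); have {}hN' := hN' _ (leq_maxr N N').
set n := maxn N N' in hN hN'.
have -> : rip l y - rip x m = rip x (v n - m) - rip (u n - l) y.
  by rewrite !ripE h; ring.
apply: le_trans (ler_normB _ _) _.
apply: le_trans (lerD (rip_le _ _) (rip_le _ _)) _.
have -> : e = hnorm x * (e / c) + (e / c) * hnorm y + e / c.
  by rewrite /c; field; rewrite lt0r_neq0.
rewrite -[X in X <= _]addr0 lerD ?(ltW ec) // lerD //.
- by rewrite ler_wpM2l // ltW.
- by rewrite ler_wpM2r // ltW.
Qed.


(** * Limits of operator sequences majorized by a scalar sequence *)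

Lemma bounded_nondecreasing_cauchy (r : nat -> R) (C : R) :
  (forall n, r n <= r n.+1) -> (forall n, r n <= C) ->
  forall e, 0 < e -> exists N, forall m n, (N <= m)%N -> (N <= n)%N -> `|r m - r n| < e.
Proof.
move=> r1 rC e e0; pose E : classical_sets.set R := fun y => exists n, y = r n.
have sE : classical_sets.has_sup E.
  by split; [exists (r 0%N); exists 0%N | exists C => _ [n ->]].
have rmono m n : (m <= n)%N -> r m <= r n by apply: (homo_leq (lexx) (@le_trans _ _)).
(* From this [N] on, all terms lie between [sup E - e] and [sup E]. *)
have [_ [N ->] hN] := sup_adherent e0 sE.
exists N => m n /rmono hm /rmono hn.
have hs k : r k <= sup E by apply: (sup_upper_bound sE); exists k.
by have := hs m; have := hs n; rewrite ltr_norml; lra.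
Qed.

Section MajorizedSequence.
Variables (Z : nat -> V -> V) (r : nat -> R) (C : R).
Hypothesis linZ : forall n a x y, Z n (a *: x + y) = a *: Z n x + Z n y.
Hypothesis Z_step : forall n x, hnorm (Z n.+1 x - Z n x) <= (r n.+1 - r n) * hnorm x.
Hypothesis Z_le : forall n x, hnorm (Z n x) <= r n * hnorm x.
Hypothesis r_step : forall n, r n <= r n.+1.
Hypothesis r_le : forall n, r n <= C.

(** Telescoping bounds [Z n x - Z m x] by [(r n - r m) |x|], so every orbit is Cauchy. It serves
    both the square root iteration and the Neumann series. *)
Lemma majorized_limit : exists L, bounded_op L /\
  (forall x, hnorm (L x) <= C * hnorm x) /\
  (forall x, converges_to (fun n => Z n x) (L x)).
Proof.
have dist m k x : hnorm (Z (m + k)%N x - Z m x) <= (r (m + k)%N - r m) * hnorm x.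
  elim: k => [|k IH]; first by rewrite addn0 !subrr hnorm0 mul0r.
  rewrite addnS; apply: le_trans (hnorm_triangle (Z (m + k)%N x) _ _) _.
  by apply: le_trans (lerD (Z_step _ _) IH) _; rewrite -mulrDl addrA subrK.
have cauchy x : cauchy_seq ip (fun n => Z n x).
  (* Dividing by [|x| + 1] rather than [|x|] covers [x = 0]. *)
  move=> e e0; have hx := hnorm_ge0 x; have h1 : 0 < hnorm x + 1 by lra.
  have ec : 0 < e / (hnorm x + 1) by rewrite divr_gt0.
  have [N hN] := bounded_nondecreasing_cauchy r_step r_le ec.
  have aux m n : (N <= m)%N -> (m <= n)%N -> hnorm (Z n x - Z m x) < e.
    move=> Nm mn; apply: (@le_lt_trans _ _ (e / (hnorm x + 1) * hnorm x)); last first.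
      rewrite -mulrA gtr_pMr // mulrC ltr_pdivrMr // mul1r; lra.
    have := dist m (n - m)%N x; rewrite subnKC // => h; apply: le_trans h _.
    rewrite ler_wpM2r //; apply: le_trans (ler_norm _) (ltW _).
    by apply: hN => //; apply: leq_trans mn.
  exists N => m n Nm Nn; case/orP: (leq_total m n) => h; last exact: aux.
  by rewrite hnormB; apply: aux.
have [L hL] := boolp.choice (fun x => ip_complete hilb (cauchy x)).
have LC x : hnorm (L x) <= C * hnorm x.
  apply: converges_norm_le (hL x) => n; apply: le_trans (Z_le n x) _.
  by rewrite ler_wpM2r ?hnorm_ge0.
exists L; split=> //; split; last by exists C.
move=> a x y; apply: converges_unique (hL _) _.
apply: (@converges_eq (fun n => a *: Z n x + Z n y)) => [n|]; first by rewrite linZ.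
exact: converges_add (converges_bounded (bounded_scale a) (hL x)) (hL y).
Qed.

End MajorizedSequence.

Lemma limit_sym Z L : (forall x, converges_to (fun n => Z n x) (L x)) ->
  (forall n x y, rip (Z n x) y = rip x (Z n y)) -> forall x y, rip (L x) y = rip x (L y).
Proof. by move=> hL hZ x y; apply: (converges_rip _ (hL x) (hL y)) => n; apply: hZ. Qed.

Lemma limit_commute Z L T : bounded_op T ->
  (forall x, converges_to (fun n => Z n x) (L x)) ->
  (forall n, commute_op T (Z n)) -> commute_op T L.
Proof.
move=> bT hL hZ x; apply: converges_unique (converges_bounded bT (hL x)) _.
by apply: converges_eq (hL (T x)) => n; rewrite hZ.
Qed.

(** * The iteration for the square root of [1 - K] *)

Fixpoint sqrt_iter (K : V -> V) (n : nat) (x : V) : V :=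
  if n is n'.+1 then (2^-1 : R)%:C%C *: (K x + sqrt_iter K n' (sqrt_iter K n' x)) else 0.

Fixpoint sqrt_bound (n : nat) : R :=
  if n is n'.+1 then 2^-1 * (1 + sqrt_bound n' ^+ 2) else 0.

Lemma sqrt_bound_ge0 n : 0 <= sqrt_bound n.
Proof. by case: n => //= n; rewrite mulr_ge0 ?invr_ge0 ?addr_ge0 ?sqr_ge0. Qed.

Lemma sqrt_bound_le1 n : sqrt_bound n <= 1.
Proof. elim: n => [|n IH] /=; first exact: ler01; have := sqrt_bound_ge0 n; nra. Qed.

Lemma sqrt_bound_step n : sqrt_bound n <= sqrt_bound n.+1.
Proof. rewrite /=; have := sqr_ge0 (1 - sqrt_bound n); lra. Qed.

Section SqrtIter.
Variable K : V -> V.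
Hypothesis bK : bounded_op K.

Lemma sqrt_iter_linear n a x y :
  sqrt_iter K n (a *: x + y) = a *: sqrt_iter K n x + sqrt_iter K n y.
Proof.
elim: n x y => [|n IH] x y /=; first by rewrite scaler0 addr0.
by rewrite !IH bK.1 addrACA -scalerDr [LHS]scalerDr !scalerA (mulrC a).
Qed.

(** The iterates are polynomials in [K]. Asking only linearity of [T] lets [T] itself be an
    iterate. *)
Lemma sqrt_iter_commute T n : (forall a x y, T (a *: x + y) = a *: T x + T y) ->
  commute_op T K -> commute_op T (sqrt_iter K n).
Proof.
move=> lT TK; elim: n => [|n IH] x /=; first exact: linmap0.
by rewrite (linmapZ lT) (linmapD lT) TK !IH.
Qed.

Lemma sqrt_iter_sym : (forall x y, rip (K x) y = rip x (K y)) ->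
  forall n x y, rip (sqrt_iter K n x) y = rip x (sqrt_iter K n y).
Proof.
move=> sK; elim=> [|n IH] x y /=; first by rewrite (rip_sym x) !rip0l.
by rewrite !ripE sK !IH.
Qed.

Hypothesis K1 : forall x, hnorm (K x) <= hnorm x.

Lemma sqrt_iter_le n x : hnorm (sqrt_iter K n x) <= sqrt_bound n * hnorm x.
Proof.
elim: n x => [|n IH] x /=; first by rewrite hnorm0 mul0r.
rewrite hnormZr ?invr_ge0 // -mulrA ler_pM2l ?invr_gt0 //.
apply: le_trans (hnormD _ _) _; rewrite mulrDl mul1r lerD //.
apply: le_trans (IH _) _; rewrite expr2 -mulrA ler_wpM2l ?sqrt_bound_ge0 //.
Qed.

Lemma sqrt_iter_step n x :
  hnorm (sqrt_iter K n.+1 x - sqrt_iter K n x) <=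
  (sqrt_bound n.+1 - sqrt_bound n) * hnorm x.
Proof.
elim: n x => [|n IH] x.
  rewrite !subr0 /= expr0n /= !addr0 mulr1 hnormZr ?invr_ge0 //.
  by rewrite ler_pM2l ?invr_gt0.
set Y := sqrt_iter K n; set Y' := sqrt_iter K n.+1.
have YY' : commute_op Y Y'.
  apply: sqrt_iter_commute; first exact: sqrt_iter_linear.
  by move=> y; symmetry; apply: sqrt_iter_commute bK.1 _ y.
have linY : forall a x y, Y (a *: x + y) = a *: Y x + Y y by apply: sqrt_iter_linear.
have linY' : forall a x y, Y' (a *: x + y) = a *: Y' x + Y' y by apply: sqrt_iter_linear.
(* [Y'^2 - Y^2 = (Y' + Y)(Y' - Y)] since the iterates commute *)
have -> : sqrt_iter K n.+2 x - sqrt_iter K n.+1 x =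
    (2^-1 : R)%:C%C *: (Y' (Y' x - Y x) + Y (Y' x - Y x)).
  rewrite (linmapB linY) (linmapB linY') (YY' x) addrA subrK.
  rewrite -[LHS]/(_ *: (K x + Y' (Y' x)) - _ *: (K x + Y (Y x))) -scalerBr.
  by rewrite opprD addrACA subrr add0r.
rewrite hnormZr ?invr_ge0 //.
(* The scalar bounds factor in the same way, and [Y' + Y] is dominated by the sum of the two
   bounds. *)
have -> : sqrt_bound n.+2 - sqrt_bound n.+1 =
  2^-1 * (sqrt_bound n.+1 + sqrt_bound n) * (sqrt_bound n.+1 - sqrt_bound n).
  have e m : sqrt_bound m.+1 = 2^-1 * (1 + sqrt_bound m ^+ 2) by [].
  by rewrite (e n.+1); have := e n; lra.
rewrite -!mulrA ler_pM2l ?invr_gt0 //; apply: le_trans (hnormD _ _) _.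
apply: le_trans (lerD (sqrt_iter_le _ _) (sqrt_iter_le _ _)) _.
by rewrite -mulrDl ler_wpM2l ?addr_ge0 ?sqrt_bound_ge0 //; apply: IH.
Qed.

End SqrtIter.


Lemma contraction_sqrt (K : V -> V) :
  bounded_op K -> (forall x y, rip (K x) y = rip x (K y)) ->
  (forall x, hnorm (K x) <= hnorm x) ->
  exists P, positive_op P /\ (forall x, P (P x) = x - K x) /\
    forall T, bounded_op T -> commute_op T K -> commute_op T P.
Proof.
move=> bK sK K1.
have [Y [bY [Y1 cvY]]] := majorized_limit (sqrt_iter_linear bK) (sqrt_iter_step bK K1)
  (sqrt_iter_le K1) sqrt_bound_step sqrt_bound_le1.
have {}Y1 x : hnorm (Y x) <= hnorm x by rewrite -[leRHS]mul1r.
have sY : forall x y, rip (Y x) y = rip x (Y y) := limit_sym cvY (sqrt_iter_sym sK).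
(* With [Y_n (Y x)] inserted, the first difference is [Y_n] applied to [Y_n x - Y x], and [Y_n] is a
   contraction. *)
have cvYY x : converges_to (fun n => sqrt_iter K n (sqrt_iter K n x)) (Y (Y x)).
  move=> e e0; have e2 : 0 < e / 2 by lra.
  have [N hN] := cvY x _ e2; have [N' hN'] := cvY (Y x) _ e2.
  exists (maxn N N') => n; rewrite geq_max => /andP[/hN h /hN' h'].
  apply: le_lt_trans (hnorm_triangle (sqrt_iter K n (Y x)) _ _) _.
  rewrite -(linmapB (sqrt_iter_linear bK n)).
  have := sqrt_iter_le K1 n (sqrt_iter K n x - Y x).
  have := hnorm_ge0 (sqrt_iter K n x - Y x); have := sqrt_bound_le1 n; nra.
have Yfix x : Y x = (2^-1 : R)%:C%C *: (K x + Y (Y x)).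
  apply: converges_unique (converges_shift (cvY x)) _ => /=.
  apply: (converges_bounded (bounded_scale _)).
  by apply: converges_add (cvYY x); apply: converges_cst.
exists (fun x => x - Y x); split; last split.
- apply: positive_intro => [|x y|x].
  + exact: bounded_sub bounded_id bY.
  + by rewrite !ripE sY.
  + rewrite !ripE subr_ge0; apply: le_trans (ler_norm _) (le_trans (rip_le _ _) _).
    by rewrite -hnorm_sqr expr2 ler_wpM2r ?hnorm_ge0.
(* [(1 - Y)^2 = 1 - 2 Y + Y^2 = 1 - K], because [2 Y = K + Y^2]. *)
- move=> x; rewrite (linmapB bY.1); apply: rip_ext => z.
  have e : rip (Y x) z = 2^-1 * (rip (K x) z + rip (Y (Y x)) z).
    by rewrite {1}Yfix !ripE.
  rewrite !ripE; lra.
- move=> T bT TK x; rewrite (linmapB bT.1); congr (_ - _).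
  by apply: (limit_commute bT cvY) => n; apply: sqrt_iter_commute bT.1 TK.
Qed.

(** From [m <= T <= c] follows [0 <= K <= q] with [q = 1 - m / c], and [K^2 <= q K] turns the form
    bound into a norm bound. The case [m = 0] feeds the square root, [m > 0] the Neumann series. *)
Lemma positive_complement (T : V -> V) (c m : R) :
  positive_op T -> 0 < c -> m <= c ->
  (forall x, m * rip x x <= rip (T x) x) -> (forall x, rip (T x) x <= c * rip x x) ->
  let K := fun x => x - (c^-1)%:C%C *: T x in
  positive_op K /\ forall x, hnorm (K x) <= (1 - m / c) * hnorm x.
Proof.
move=> pT c0 mc hm hc K; have ci : 0 < c^-1 by rewrite invr_gt0.
have q0 : 0 <= 1 - m / c by rewrite subr_ge0 ler_pdivrMr // mul1r.
have pK : positive_op K.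
  apply: positive_intro => [|x y|x].
  - exact: bounded_sub bounded_id (bounded_comp (bounded_scale _) pT.1).
  - by rewrite !ripE (positive_sym pT).
  - rewrite !ripE subr_ge0 mulrC ler_pdivrMr // mulrC; exact: hc.
have Kq x : rip (K x) x <= (1 - m / c) * rip x x.
  have : c^-1 * (m * rip x x) <= c^-1 * rip (T x) x by rewrite ler_pM2l.
  rewrite !ripE; lra.
split=> // x; apply: hnorm_le; first by rewrite mulr_ge0 ?hnorm_ge0.
rewrite exprMn hnorm_sqr; apply: le_trans (positive_norm_sqr pK Kq x) _.
by rewrite expr2 -mulrA ler_wpM2l.
Qed.

(** * Existence, uniqueness and commutation of positive square roots *)

Lemma positive_upper (T : V -> V) : bounded_op T ->
  exists2 c, 0 < c & forall x, rip (T x) x <= c * rip x x.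
Proof.
move=> bT; have [c c0 hc] := bounded_ge0 bT; exists c => // x.
apply: le_trans (ler_norm _) (le_trans (rip_le _ _) _).
by rewrite -hnorm_sqr expr2 mulrA ler_wpM2r ?hnorm_ge0.
Qed.

Lemma commute_complement (T S : V -> V) (c : R) : bounded_op T -> commute_op T S ->
  commute_op T (fun x => x - c%:C%C *: S x).
Proof. by move=> bT TS x; rewrite (linmapB bT.1) (linmapZ bT.1) TS. Qed.

Lemma positive_scale (c : R) T : 0 <= c -> positive_op T -> positive_op (fun x => c%:C%C *: T x).
Proof.
move=> c0 pT; apply: positive_intro => [|x y|x].
- exact: (bounded_comp (bounded_scale _) pT.1).
- by rewrite !ripE (positive_sym pT).
- by rewrite ripE mulr_ge0 ?positive_rip.
Qed.

(** Write [T = c (1 - K)] with [K] a contraction; the root is [sqrt c] times that of [1 - K]. The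
    commutation clause is what uniqueness rests on. *)
Lemma positive_sqrt_exists T : positive_op T ->
  exists P, is_pos_sqrt ip T P /\
    forall S, bounded_op S -> commute_op S T -> commute_op S P.
Proof.
move=> pT; have [c c0 hc] := positive_upper pT.1.
have hm x : 0 * rip x x <= rip (T x) x by rewrite mul0r positive_rip.
have [pK K1] := positive_complement pT c0 (ltW c0) hm hc.
set K := (fun x => _) in pK K1.
have {}K1 x : hnorm (K x) <= hnorm x by have := K1 x; rewrite mul0r subr0 mul1r.
have [P [pP [PP cP]]] := contraction_sqrt pK.1 (positive_sym pK) K1.
exists (fun x => (Num.sqrt c)%:C%C *: P x); split; first split.
- by apply: positive_scale => //; apply: sqrtr_ge0.
- move=> x; rewrite (linmapZ pP.1.1) scalerA -rmorphM /= -expr2 sqr_sqrtr ?ltW //.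
  rewrite PP /K opprB addrCA subrr addr0 scalerA -rmorphM /= mulfV ?lt0r_neq0 //.
  by rewrite rmorph1 scale1r.
- move=> S bS ST x; rewrite (linmapZ bS.1); congr (_ *: _).
  by apply: (cP _ bS); apply: commute_complement ST.
Qed.

Lemma pos_sqrt_commute T S P : is_pos_sqrt ip T S -> is_pos_sqrt ip T P ->
  commute_op S P -> forall x, S x = P x.
Proof.
move=> [pS SS] [pP PP] SP x; have [bS bP] := (pS.1, pP.1).
pose d := fun x => P x - S x.
have sd y z : rip (d y) z = rip y (d z).
  by rewrite !ripE (positive_sym pP) (positive_sym pS).
(* [(P + S) (P - S) = P^2 - S^2 = 0] as [P] and [S] commute; both summands are nonnegative at [d x],
   so both vanish. *)
have dd0 y : rip (P (d y)) (d y) + rip (S (d y)) (d y) = 0.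
  rewrite -ripDl /d (linmapB bS.1) (linmapB bP.1) SS PP SP addrA subrK subrr.
  by rewrite rip0l.
have hP := positive_rip pP (d x); have hS := positive_rip pS (d x).
have {}hP : P (d x) = 0 by apply: positive_ker => //; have := dd0 x; lra.
have {}hS : S (d x) = 0 by apply: positive_ker => //; have := dd0 x; rewrite hP rip0l; lra.
have : d x = 0 by apply: rip_eq0; rewrite sd {1}/d hP hS subrr rip_sym rip0l.
by move/eqP; rewrite subr_eq0 => /eqP.
Qed.

(** A root [W] commutes with [T = W^2], hence with the constructed root [Q]; the commuting case then
    gives [W = Q]. *)
Lemma pos_sqrt_unique T S P : positive_op T -> is_pos_sqrt ip T S -> is_pos_sqrt ip T P ->
  forall x, S x = P x.
Proof.
move=> pT hS hP x; have [Q [hQ cQ]] := positive_sqrt_exists pT.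
have aux W : is_pos_sqrt ip T W -> forall y, W y = Q y.
  move=> hW; apply: (pos_sqrt_commute hW hQ); apply: cQ; first by case: hW => -[].
  by case: hW => _ WW y; rewrite -!WW.
by rewrite aux // aux.
Qed.

Lemma sqrt_opP T : positive_op T -> is_pos_sqrt ip T (sqrt_op ip T).
Proof.
move=> pT; apply: ClassicalEpsilon.epsilon_spec; have [P [hP _]] := positive_sqrt_exists pT.
by exists P.
Qed.

Lemma sqrt_op_commute T S : positive_op T -> bounded_op S -> commute_op S T ->
  commute_op S (sqrt_op ip T).
Proof.
move=> pT bS ST x; have [P [hP cP]] := positive_sqrt_exists pT.
by rewrite !(pos_sqrt_unique pT (sqrt_opP pT) hP) cP.
Qed.

(** * Neumann series, coercivity and invertibility *)

Lemma Neumann (K : V -> V) (q : R) : bounded_op K -> 0 <= q -> q < 1 ->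
  (forall x, hnorm (K x) <= q * hnorm x) ->
  exists L, bounded_op L /\ (forall x, L x - K (L x) = x) /\ (forall x, L (x - K x) = x).
Proof.
move=> bK q0 q1 hK.
(* In Horner form, [Z n] is the sum of [K^j] over [j < n], and [r n] the corresponding geometric sum
   in [q]. *)
pose Z n x := iter n (fun y => x + K y) 0; pose r n := iter n (fun t => 1 + q * t) 0.
have linZ n a x y : Z n (a *: x + y) = a *: Z n x + Z n y.
  elim: n => [|n IH] /=; first by rewrite scaler0 addr0.
  by rewrite -/(Z n _) IH bK.1 addrACA scalerDr.
have r0 n : 0 <= r n by elim: n => //= n IH; rewrite addr_ge0 ?mulr_ge0.
have r_step n : r n <= r n.+1.
  elim: n => [|n IH]; first by rewrite /= mulr0 addr0.
  by rewrite /= lerD2l ler_wpM2l.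
have r_le n : r n <= (1 - q)^-1.
  have q' : 0 < 1 - q by lra.
  elim: n => [|n IH] /=; first by rewrite invr_ge0 ltW.
  apply: le_trans (lerD (lexx _) (ler_wpM2l q0 IH)) _.
  by rewrite -subr_ge0 (_ : _ - _ = 0) //; field; rewrite lt0r_neq0.
have Z_le n x : hnorm (Z n x) <= r n * hnorm x.
  elim: n => [|n IH] /=; first by rewrite hnorm0 mul0r.
  apply: le_trans (hnormD _ _) _; rewrite mulrDl mul1r lerD // -mulrA.
  by apply: le_trans (hK _) _; rewrite ler_wpM2l.
have Z_step n x : hnorm (Z n.+1 x - Z n x) <= (r n.+1 - r n) * hnorm x.
  elim: n => [|n IH]; first by rewrite /= (linmap0 bK.1) mulr0 !addr0 !subr0 mul1r.
  have -> : Z n.+2 x - Z n.+1 x = K (Z n.+1 x) - K (Z n x).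
    by rewrite /Z !iterS opprD addrACA subrr add0r.
  have -> : r n.+2 - r n.+1 = q * r n.+1 - q * r n.
    by rewrite /r !iterS opprD addrACA subrr add0r.
  rewrite -(linmapB bK.1) -mulrBr -mulrA; apply: le_trans (hK _) _.
  by rewrite ler_wpM2l.
have [L [bL [_ cvL]]] := majorized_limit linZ Z_step Z_le r_step r_le.
have KZ n : commute_op K (Z n).
  move=> x; elim: n => [|n IH] /=; first exact: linmap0 bK.1.
  by rewrite (linmapD bK.1) IH.
have KL := limit_commute bK cvL KZ.
have Lfix x : L x = x + K (L x).
  apply: converges_unique (converges_shift (cvL x)) _ => /=.
  by apply: converges_add (converges_bounded bK (cvL x)); apply: converges_cst.
exists L; split=> //; have inv x : L x - K (L x) = x by rewrite {1}Lfix addrK.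
by split=> // x; rewrite (linmapB bL.1) -KL.
Qed.

Lemma coercive_invertible T m : positive_op T -> 0 < m ->
  (forall x, m * rip x x <= rip (T x) x) -> invertible_op ip T.
Proof.
move=> pT m0 hm; have [c' c'0 hc'] := positive_upper pT.1.
(* Adding [m] secures [m <= c], so that [T = c (1 - K)] with [|K| <= 1 - m / c < 1]. *)
pose c := c' + m; have c0 : 0 < c by rewrite /c addr_gt0.
have mc : m <= c by rewrite /c lerDr ltW.
have hc x : rip (T x) x <= c * rip x x.
  by apply: le_trans (hc' x) _; rewrite ler_wpM2r ?rip_ge0 // /c lerDl ltW.
have [pK K1] := positive_complement pT c0 mc hm hc.
have q0 : 0 <= 1 - m / c by rewrite subr_ge0 ler_pdivrMr // mul1r.
have q1 : 1 - m / c < 1 by rewrite ltrBlDr ltrDl divr_gt0.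
have [L [bL [L1 L2]]] := Neumann pK.1 q0 q1 K1.
have e x : x - (x - (c^-1)%:C%C *: T x) = (c^-1)%:C%C *: T x by rewrite opprB addrCA subrr addr0.
exists (fun x => (c^-1)%:C%C *: L x); split; last split.
- exact: (bounded_comp (bounded_scale _) bL).
- by move=> x; rewrite -(linmapZ bL.1) -e L2.
- by move=> x; rewrite (linmapZ pT.1.1) -e L1.
Qed.

(** If [k] bounds the inverse and [T <= c], then [|x|^2 <= k^2 |T x|^2 <= k^2 c <T x, x>]. *)
Lemma invertible_coercive T : positive_op T -> invertible_op ip T ->
  exists2 m, 0 < m & forall x, m * rip x x <= rip (T x) x.
Proof.
move=> pT [S [bS [ST _]]]; have [c c0 hc] := positive_upper pT.1.
have [k k0 hk] := bounded_ge0 bS.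
have kc : 0 < k ^+ 2 * c by rewrite mulr_gt0 ?exprn_gt0.
exists (k ^+ 2 * c)^-1; first by rewrite invr_gt0.
move=> x; rewrite mulrC ler_pdivrMr // mulrC -mulrA.
apply: (@le_trans _ _ (k ^+ 2 * rip (T x) (T x))); last first.
  by rewrite ler_pM2l ?exprn_gt0 //; apply: positive_norm_sqr.
rewrite -!hnorm_sqr -exprMn ler_sqr ?nnegrE ?mulr_ge0 ?hnorm_ge0 ?(ltW k0) //.
by have := hk (T x); rewrite ST.
Qed.

(** * Sums, conjugates, inverses and roots of positive operators *)

Lemma positive_add T S : positive_op T -> positive_op S -> positive_op (fun x => T x + S x).
Proof.
move=> [bT hT] [bS hS]; split=> [|x]; first exact: bounded_add.
by rewrite ipD addr_ge0.
Qed.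

Lemma positive_conjugate T S : positive_op T -> positive_op S ->
  positive_op (fun x => S (T (S x))).
Proof.
move=> pT pS; apply: positive_intro => [|x y|x].
- by apply: bounded_comp pS.1 _; apply: bounded_comp pT.1 pS.1.
- by rewrite (positive_sym pS) (positive_sym pT) (positive_sym pS).
- by rewrite (positive_sym pS); apply: positive_rip.
Qed.

Lemma inv_opP T : invertible_op ip T -> is_inverse_op ip T (inv_op ip T).
Proof. exact: ClassicalEpsilon.epsilon_spec. Qed.

Lemma inverse_commute T S U : is_inverse_op ip T S -> commute_op U T -> commute_op U S.
Proof. by move=> [_ [ST TS]] UT x; rewrite -[LHS]ST -UT TS. Qed.

Lemma inverse_positive T S : positive_op T -> is_inverse_op ip T S -> positive_op S.
Proof.
move=> pT [bS [_ TS]]; apply: positive_intro => // [x y|x].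
- by rewrite -{1}[y]TS -(positive_sym pT) TS.
- by rewrite -{2}[x]TS -(positive_sym pT); apply: positive_rip.
Qed.

(** The inverse of the root [P] is [P T^(-1)], since [P] commutes with [T = P^2] and so with its
    inverse. *)
Lemma sqrt_op_invertible T : positive_op T -> invertible_op ip T ->
  invertible_op ip (sqrt_op ip T).
Proof.
move=> pT [S iS]; have [pP PP] := sqrt_opP pT.
have PS : commute_op (sqrt_op ip T) S.
  by apply: inverse_commute iS _ => x; rewrite -!PP.
have [bS [ST TS]] := iS.
exists (fun x => sqrt_op ip T (S x)); split; first exact: bounded_comp pP.1 bS.
by split=> x; rewrite ?PS PP // -PS.
Qed.

(** * Positivity of the corner and of the determinant of a positive block matrix *)

Section PositiveBlock.
Variables A B X Xs : V -> V.
Hypotheses (bB : bounded_op B) (bX : bounded_op X) (adj : is_adjoint ip X Xs).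
Hypotheses (AX : commute_op A X) (AXs : commute_op A Xs) (AB : commute_op A B).
Hypotheses (XXs : commute_op X Xs) (XB : commute_op X B) (XsB : commute_op Xs B).
Hypotheses (pA : positive_op A) (iA : invertible_op ip A).
Hypothesis M_ge0 : forall p, 0 <= ip_sum ip (op_matrix A X Xs B p) p.

Let bXs : bounded_op Xs. Proof. exact: bounded_adjoint bX adj. Qed.

Lemma block_corner_positive : positive_op B.
Proof.
split=> // v; have := M_ge0 (0, v).
rewrite /ip_sum /op_matrix /= (linmap0 pA.1.1) (linmap0 bXs.1) !add0r.
by rewrite (ip_conj hilb 0) ip0 rmorph0 add0r.
Qed.

Let pB := block_corner_positive.

Lemma det_bounded : bounded_op (fun x => A (B x) - Xs (X x)).
Proof. by apply: bounded_sub; apply: bounded_comp => //; apply: pA.1. Qed.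

(* The matrix is tested on vectors (- X w, A w), on which its form is <det w, A w>;
   taking w = A^(-1/2) x turns this into <det x, x>. *)
Lemma det_positive : positive_op (fun x => A (B x) - Xs (X x)).
Proof.
pose D x := A (B x) - Xs (X x); have bD : bounded_op D := det_bounded.
have ripX x y : rip (X x) y = rip x (Xs y) by rewrite /rip adj.
have sD x y : rip (D x) y = rip x (D y).
  rewrite !ripE (positive_sym pA) (positive_sym pB) AB -ripX.
  by rewrite (rip_sym (Xs _)) -ripX (rip_sym (X y)).
have DA w : 0 <= rip (D w) (A w).
  have := M_ge0 (- X w, A w); rewrite /ip_sum /op_matrix /=.
  rewrite (linmapN pA.1.1) (linmapN bXs.1) AX addNr ip0 add0r addrC -AB.
  by rewrite lecE => /andP[].
have [A' iA'] := iA; have pA' := inverse_positive pA iA'.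
(* [G] is [A^(-1/2)], taken as the root of the inverse. *)
set G := sqrt_op ip A'; have [pG GG] : is_pos_sqrt ip A' G := sqrt_opP pA'.
have G_commute T : bounded_op T -> commute_op A T -> commute_op T G.
  by move=> bT AT; apply: sqrt_op_commute => //; apply: inverse_commute iA' _ => x; rewrite AT.
have GA := G_commute _ pA.1 (fun=> erefl).
have GD : commute_op D G.
  apply: G_commute => // x; rewrite /D (linmapB pA.1.1) AXs AX; congr (A _ - _); exact: AB.
apply: positive_intro => // x; have := DA (G x).
by rewrite GD (positive_sym pG) -GA GG iA'.2.2.
Qed.

End PositiveBlock.

End Hilbert.

(** * The Hilbert space direct sum *)

Section DirectSum.
Variables (R : realType) (V : lmodType R[i]) (ip : V -> V -> R[i]).
Hypothesis hilb : is_hilbert ip.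

Local Notation ip2 := (ip_sum ip).

Lemma rip_sumE p q : rip ip2 p q = rip ip p.1 q.1 + rip ip p.2 q.2.
Proof. exact: ReD. Qed.

Lemma hnorm_sum_sqr p : hnorm ip2 p ^+ 2 = hnorm ip p.1 ^+ 2 + hnorm ip p.2 ^+ 2.
Proof.
rewrite !(hnorm_sqr hilb) /Defs.hnorm -!/(rip _ _ _) rip_sumE sqr_sqrtr //.
by rewrite addr_ge0 ?rip_ge0.
Qed.

Lemma hnorm_fst_le p : hnorm ip p.1 <= hnorm ip2 p.
Proof. by rewrite -ler_sqr ?nnegrE ?hnorm_ge0 // hnorm_sum_sqr lerDl sqr_ge0. Qed.

Lemma hnorm_snd_le p : hnorm ip p.2 <= hnorm ip2 p.
Proof. by rewrite -ler_sqr ?nnegrE ?hnorm_ge0 // hnorm_sum_sqr lerDr sqr_ge0. Qed.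

Lemma hnorm_sum_le p : hnorm ip2 p <= hnorm ip p.1 + hnorm ip p.2.
Proof.
have [h1 h2] := (hnorm_ge0 ip p.1, hnorm_ge0 ip p.2).
rewrite -ler_sqr ?nnegrE ?addr_ge0 ?hnorm_ge0 // hnorm_sum_sqr; nra.
Qed.

(** Completeness is checked coordinatewise. This makes the square root theory above available for
    block matrices. *)
Lemma ip_sum_hilbert : is_hilbert ip2.
Proof.
split.
- move=> a [x x'] [y y'] [z z']; rewrite /ip_sum /= !(ip_linear hilb); ring.
- by move=> [x x'] [y y']; rewrite /ip_sum rmorphD /= -!(ip_conj hilb).
- by move=> p; rewrite addr_ge0 ?(ip_ge0 hilb).
- move=> [x y] /eqP; rewrite /ip_sum /= paddr_eq0 ?(ip_ge0 hilb) // => /andP[/eqP h /eqP h'].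
  by rewrite (ip_def hilb h) (ip_def hilb h').
- move=> u cu.
  have [l hl] : exists l, converges_to ip (fun n => (u n).1) l.
    apply: (ip_complete hilb) => e /cu[N hN]; exists N => m n Nm Nn.
    exact: le_lt_trans (hnorm_fst_le (u m - u n)) (hN _ _ Nm Nn).
  have [l' hl'] : exists l, converges_to ip (fun n => (u n).2) l.
    apply: (ip_complete hilb) => e /cu[N hN]; exists N => m n Nm Nn.
    exact: le_lt_trans (hnorm_snd_le (u m - u n)) (hN _ _ Nm Nn).
  exists (l, l') => e e0; have e2 : 0 < e / 2 by lra.
  have [N hN] := hl _ e2; have [N' hN'] := hl' _ e2.
  exists (maxn N N') => n; rewrite geq_max => /andP[/hN h /hN' h'].
  by apply: le_lt_trans (hnorm_sum_le _) _ => /=; lra.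
Qed.

Definition diag_op (T : V -> V) (p : V * V) : V * V := (T p.1, T p.2).

Lemma diag_positive T : positive_op ip T -> positive_op ip2 (diag_op T).
Proof.
move=> [bT hT]; split=> [|p]; last exact: addr_ge0 (hT _) (hT _).
split=> [a [x x'] [y y']|]; first by rewrite /diag_op /= !bT.1.
have [c c0 hc] := bounded_ge0 bT; exists (c + c) => p.
apply: le_trans (hnorm_sum_le _) _; rewrite mulrDl.
apply: lerD; apply: le_trans (hc _) _; rewrite ler_pM2l //.
- exact: hnorm_fst_le.
- exact: hnorm_snd_le.
Qed.

End DirectSum.

(** * The square root of the block matrix *)

Unset Implicit Arguments.
Set Strict Implicit.

Theorem theorem2p10 (R : realType) (V : lmodType R[i]) (ip : V -> V -> R[i])
  (A B X Xs : V -> V) :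
  is_hilbert ip ->
  bounded_op ip A -> bounded_op ip B -> bounded_op ip X ->
  is_adjoint ip X Xs ->
  commute_op A X -> commute_op A Xs -> commute_op A B ->
  commute_op X Xs -> commute_op X B -> commute_op Xs B ->
  positive_op ip A -> invertible_op ip A ->
  positive_op (ip_sum ip) (op_matrix A X Xs B) ->
  let trM := fun x => A x + B x in
  let detM := fun x => A (B x) - Xs (X x) in
  let Q := sqrt_op ip detM in
  let T := fun x => trM x + Q x *+ 2 in
  let S := inv_op ip (sqrt_op ip T) in
  positive_op ip T /\ invertible_op ip T /\
  forall p : V * V,
    sqrt_op (ip_sum ip) (op_matrix A X Xs B) p =
    op_matrix (fun x => S (A x + Q x)) (fun x => S (X x))
              (fun x => S (Xs x)) (fun x => S (B x + Q x)) p.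
Proof.
move=> hilb bA bB bX adj AX AXs AB XXs XB XsB pA iA pM trM detM Q T S.
have hilb2 := ip_sum_hilbert hilb; have bXs := bounded_adjoint hilb bX adj.
have pB : positive_op ip B := block_corner_positive hilb bB bX adj pA pM.2.
have pD : positive_op ip detM := det_positive hilb bB bX adj AX AXs AB pA iA pM.2.
have [pQ QQ] : is_pos_sqrt ip detM Q := sqrt_opP hilb pD.
(* Each entry of the matrix commutes with [detM], hence with its root [Q]. *)
have AQ : commute_op A Q.
  by apply: sqrt_op_commute => // x; rewrite /detM (linmapB bA.1) AXs AX AB.
have BQ : commute_op B Q.
  by apply: sqrt_op_commute => // x; rewrite /detM (linmapB bB.1) -!AB -XsB -XB.
have XQ : commute_op X Q.
  by apply: sqrt_op_commute => // x; rewrite /detM (linmapB bX.1) -AX XB XXs.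
have XsQ : commute_op Xs Q.
  by apply: sqrt_op_commute => // x; rewrite /detM (linmapB bXs.1) -AXs XsB XXs.
have pT : positive_op ip T.
  exact (positive_add hilb (positive_add hilb pA pB) (positive_add hilb pQ pQ)).
have [m m0 hm] := invertible_coercive hilb pA iA.
(* [T] inherits the lower bound [m] of [A], because [B] and [2 Q] are positive. *)
have iT : invertible_op ip T.
  apply: (coercive_invertible hilb pT m0) => x; apply: le_trans (hm x) _.
  rewrite /T /trM !(ripE hilb) -addrA lerDl addr_ge0 ?mulr_ge0 ?positive_rip //.
split=> //; split=> // p.
set P := sqrt_op ip T in S *; have [pP PP] : is_pos_sqrt ip T P := sqrt_opP hilb pT.
have iS : is_inverse_op ip P S := inv_opP (sqrt_op_invertible hilb pT iT).
have pS : positive_op ip S := inverse_positive hilb pP iS.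
have [bS [SP PS]] := iS.
(* With [P = T^(1/2)] and [S = T^(-1/2)], [H] is [T^(-1/4)]: it splits the factor [S] evenly between
   the two sides. *)
set H := sqrt_op ip S; have [pH HH] : is_pos_sqrt ip S H := sqrt_opP hilb pS.
have T_commute U : bounded_op ip U -> commute_op U A -> commute_op U B ->
    commute_op U Q -> commute_op U T.
  by move=> bU UA UB UQ x; rewrite /T /trM !(linmapD bU.1) UA UB UQ.
have S_commute U : bounded_op ip U -> commute_op U T -> commute_op U S.
  by move=> bU UT; apply: inverse_commute iS _; apply: sqrt_op_commute.
have H_commute U : bounded_op ip U -> commute_op U T -> commute_op U H.
  by move=> bU UT; apply: sqrt_op_commute => //; apply: S_commute.
have TA : commute_op A T by apply: T_commute.
have TB : commute_op B T by apply: T_commute => // x; rewrite AB.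
have TX : commute_op X T by apply: T_commute => // x; rewrite AX.
have TXs : commute_op Xs T by apply: T_commute => // x; rewrite AXs.
have TQ : commute_op Q T by apply: T_commute pQ.1 _ _ _ => x; rewrite ?AQ ?BQ.
have SST x : S (S (T x)) = x by rewrite -PP !SP.
set N := op_matrix (fun x => S (A x + Q x)) _ _ _.
have pN : positive_op (ip_sum ip) N.
  (* [N] is [M + diag(Q)] conjugated by [diag(H)]; the two factors [H] merge into [S] because [H]
     commutes with all entries. *)
  have := positive_conjugate hilb2 (positive_add hilb2 pM (diag_positive hilb pQ))
    (diag_positive hilb pH).
  congr (positive_op _ _); apply: boolp.funext => -[u v].
  rewrite /N /op_matrix /diag_op /=.
  rewrite !(H_commute A, H_commute B, H_commute X, H_commute Xs, H_commute Q) //; try exact: pQ.1.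
  by rewrite -!(linmapD pH.1.1) !HH -!(linmapD bS.1) !addrA [A u + _ + _]addrAC.
(* By uniqueness, it remains to see that [N] squares to [M]. *)
apply: (pos_sqrt_unique hilb2 pM (sqrt_opP hilb2 pM)); split=> // -[u v].
have bQ := pQ.1.
rewrite /N /op_matrix /= -!(linmapD bS.1).
rewrite !(S_commute A, S_commute B, S_commute X, S_commute Xs, S_commute Q) //.
(* Writing each row of [M] as [S S T] of itself and cancelling [S S] leaves [(M + Q)^2 = T M]. *)
rewrite -!(linmapD bS.1); congr (_, _); rewrite -[RHS]SST; congr (S (S _)).
(* The entries are [(A + Q)^2 + X Xs = T A], from [Q^2 + X Xs = A B], and
   [(A + Q) X + X (B + Q) = T X]; the second row is analogous. *)
- apply: (rip_ext hilb) => z; rewrite /T /trM.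
  rewrite !(linmapD bA.1, linmapD bB.1, linmapD bX.1, linmapD bQ.1).
  rewrite -!(AB, AX, AQ, XB, XQ) QQ /detM XXs; rewrite !(ripE hilb); ring.
- apply: (rip_ext hilb) => z; rewrite /T /trM.
  rewrite !(linmapD bA.1, linmapD bB.1, linmapD bXs.1, linmapD bQ.1).
  rewrite -!(AB, AXs, BQ, XsB, XsQ) QQ /detM; rewrite !(ripE hilb); ring.
Qed.
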